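(* Let $\Omega$ be any infinite set and let $f,g\in\Omega^\Omega$. Then $\langle\operatorname{Sym}(\Omega),f,g\rangle=\Omega^\Omega$ if and only if (up to renaming $f$ and $g$) $f$ is injective, $d(f)=|\Omega|$, $g$ is surjective, and either: (i) $|\Omega|$ is regular and $k(g,|\Omega|)=|\Omega|$; or (ii) $|\Omega|$ is singular and $k(g,\nu)=|\Omega|$ for all cardinals $\nu<|\Omega|$.
   Context: $\Omega^\Omega$ is the semigroup of all mappings from $\Omega$ to itself (written to the right of their arguments and composed from left to right), and $\operatorname{Sym}(\Omega)$ is the symmetric group on $\Omega$. $\langle\,\cdot\,\rangle$ denotes the subsemigroup generated. For $f\in\Omega^\Omega$, $d(f)=|\Omega\setminus\Omega f|$, and for a cardinal $\mu\leq|\Omega|$, $k(f,\mu)=|\{\alpha\in\Omega:|\alpha f^{-1}|\geq\mu\}|$, where $\alpha f^{-1}=\{\beta\in\Omega:\beta f=\alpha\}$. *)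

(* Defs.v *)
From mathcomp Require Import all_boot.
From mathcomp Require Import wochoice boolp classical_sets functions cardinality.

Set Implicit Arguments.
Unset Strict Implicit.
Unset Printing Implicit Defensive.

Local Open Scope classical_set_scope.
Local Open Scope card_scope.

(* A cardinal is represented by any set having that cardinality; every        *)
(* cardinal mu <= |T| is the cardinality of some M : set T.                   *)

Definition card_lt T U (A : set T) (B : set U) : bool :=
  (A #<= B) && (A #!= B).

Notation "A '#<' B" := (card_lt A B) (at level 79) : card_scope.

(* R orders T in the order type of the initial ordinal |T|: the set of        *)
(* strict predecessors of any element has cardinality < |T|.                  *)
Definition initial_well_order T (R : rel T) : Prop :=
  well_order R /\ forall x, [set y | R y x /\ y <> x] #< [set: T].

Definition cofinal T (R : rel T) (C : set T) : Prop :=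
  forall x, exists2 c, C c & R x c.

(* |T| is equal to its own cofinality. The order R is unique up to            *)
(* isomorphism, so the choice of R is immaterial.                             *)
Definition regular_card (T : Type) : Prop :=
  infinite_set [set: T] /\
  exists2 R : rel T, initial_well_order R &
    forall C : set T, cofinal R C -> C #= [set: T].

Definition singular_card (T : Type) : Prop :=
  infinite_set [set: T] /\ ~ regular_card T.

Section Transformations.
Context {T : Type}.
Implicit Types (f : T -> T) (F S : set (T -> T)).

Definition Sym : set (T -> T) := [set h | bijective h].

(* f \; g applies f first, which is the product of maps written on the right  *)
(* of their arguments.                                                        *)
Definition subsemigroup S : Prop :=
  forall f g, S f -> S g -> S (f \; g).

Definition semigroup_gen F : set (T -> T) := smallest subsemigroup F.

(* d(f) = |defect f| *)
Definition defect f : set T := ~` range f.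

(* k(f, |M|) = |large_fibres f M| *)
Definition large_fibres U f (M : set U) : set T :=
  [set a | M #<= f @^-1` [set a]].

End Transformations.

Arguments Sym T : clear implicits.

(* Main.v *)
Require Import Defs.
From mathcomp Require Import all_boot.
From mathcomp Require Import wochoice boolp classical_sets functions cardinality.

(** Write |T| for the cardinal of the infinite set T = Omega; products are read
from left to right, so [u \; q \; v] applies [u] first. Call a subset of T full
if its cardinality is |T| and small otherwise.

Necessity rests on one remark: if a class of maps is closed under composition
and contains Sym(T), f and g, it contains every map, so a class that misses
some map must already miss f or g. Five such classes do the work.
- Maps that are bijective or non-injective, and maps that are bijective or
  non-surjective: hence one generator is injective, the other surjective, and
  neither is a bijection ([generator_inj_nonbij], [generator_surj_nonbij]).
- Maps with small defect, closed because the defect of [h \; k] lies in the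
  union of the defect of k and the image under k of the defect of h.
- If |T| is regular, maps with a small set of full fibres. A fibre of [h \; k]
  is a union of fibres of h indexed by a fibre of k, and a small union of small
  sets is small, so a point with a full fibre under [h \; k] has a full fibre
  under k or is the image under k of a point with a full fibre under h.
- If |T| is singular, maps for which some small cardinal N bounds all but a
  small set of fibres. If N serves for h and for k, then N * N bounds all but a
  small set of the fibres of [h \; k], and since |T| is a limit cardinal there
  is a small cardinal that is not at most N * N ([singular_card_limit]).

Sufficiency rests on [permutation_into]: given an injection i into T whose
range has a full complement, and a full target set for each index x, there is a
permutation that sends each i(x) into the target of x.
- If every fibre of v is full and u is injective with full defect, any h is
  [u \; q \; v], where the permutation q sends u(x) into the fibre of v over
  h(x) ([factor_through_full_fibres]).
- If v is onto and has |T| full fibres, some [v \; q \; v] has only full fibres: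
  take a transversal of the fibres of v and let the inverse of q send it into
  the set of points with full fibre ([full_fibre_product]).
- If |T| is singular with a small cofinal set C, and v has |T| fibres of size at
  least N for each small N, some [v \; q \; v] has |T| full fibres: inside
  each of |T| fibres of v of size at least |C| choose distinct points indexed by
  C, and let the inverse of q send the point of index c to a point whose fibre is at
  least as large as the initial segment up to c. These segments cover T
  ([singular_large_product]), and the previous case applies.

All this uses the comparability of cardinals, the equality of an infinite
cardinal with its square and the existence of an initial well-order on T. The
first two are obtained by Zorn's lemma on graphs of partial injections, the
third by transporting an arbitrary well-order along an injection into its
shortest full initial segment. *)
Set Implicit Arguments.
Unset Strict Implicit.
Unset Printing Implicit Defensive.

Local Open Scope classical_set_scope.
Local Open Scope card_scope.

(** * Cardinal comparison by injections *)

Lemma set_inj_card_le T U (A : set T) (B : set U) (f : T -> U) :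
  set_fun A B f -> set_inj A f -> A #<= B.
Proof.
move=> fAB finj; have [h] : $|{injfun A >-> B}| by apply/injfunPex; exists f.
exact: inj_card_le.
Qed.

(** An injection given only by its graph, as the maximal objects produced by
Zorn's lemma are. *)
Lemma rel_card_le T U (A : set T) (B : set U) (G : T -> U -> Prop) :
  (forall x, A x -> exists2 y, B y & G x y) ->
  (forall x x' y, A x -> A x' -> G x y -> G x' y -> x = x') ->
  A #<= B.
Proof.
move=> tot ginj.
have [[u0]|U0] := pselect (inhabited U); last first.
  suff -> : A = set0 by exact: card_ge0.
  by apply/seteqP; split=> // x /tot [y]; case: U0.
have /choice[f fP] x : exists y, A x -> B y /\ G x y.
  have [/tot[y By Gxy]|nA] := pselect (A x); first by exists y.
  by exists u0.
apply: (@set_inj_card_le _ _ _ _ f) => [x /fP[]//|x y].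
rewrite !inE => Ax Ay fxy; apply: (ginj _ _ (f x)) => //.
  by case: (fP x Ax).
by rewrite fxy; case: (fP y Ay).
Qed.

Lemma card_le_set_inj T U (u0 : U) (A : set T) (B : set U) :
  A #<= B -> exists2 f : T -> U, set_fun A B f & set_inj A f.
Proof.
elim/Ppointed: U => U in u0 B *; first by have := no u0.
by move=> /pcard_leP/injfunPex.
Qed.

Lemma card_eq_set_bij T U (u0 : U) (A : set T) (B : set U) :
  A #= B -> exists f : T -> U, set_bij A B f.
Proof.
elim/Ppointed: U => U in u0 B *; first by have := no u0.
by move=> /card_set_bijP.
Qed.

Definition partial_injection T U (G : set (T * U)) :=
  forall p q, G p -> G q -> p.1 = q.1 <-> p.2 = q.2.

Lemma partial_injection_chain T U (F : set (set (T * U))) :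
  F `<=` @partial_injection T U -> total_on F subset ->
  partial_injection (\bigcup_(G in F) G).
Proof.
move=> FP tot p q [G FG Gp] [H FH Hq].
by have [GH|HG] := tot _ _ FG FH; [apply: (FP H)|apply: (FP G)] => //;
  [apply: GH|apply: HG].
Qed.

(** A maximal partial injection between A and B is defined on all of A or onto
B: otherwise a pair of missing points could be added to it. *)
Theorem card_le_total T U (A : set T) (B : set U) : (A #<= B) || (B #<= A).
Proof.
pose P (G : set (T * U)) := partial_injection G /\ G `<=` A `*` B.
have [F FP tot|G [[Gpi GAB] Gmax]] := @Zorn_bigcup _ P.
  split; first by apply: partial_injection_chain => // G /FP[].
  by move=> p [G /FP[_ GAB] /GAB].
have [domG|/existsNP[a /not_implyP[Aa aG]]] :=
    pselect (forall x, A x -> exists y, G (x, y)).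
  apply/orP; left; apply: (@rel_card_le _ _ _ _ (fun x y => G (x, y))).
    by move=> x /domG[y Gxy]; exists y => //; have [] := GAB _ Gxy.
  by move=> x x' y _ _ Gxy Gx'y; apply/(Gpi _ _ Gxy Gx'y).
apply/orP; right; apply: (@rel_card_le _ _ _ _ (fun y x => G (x, y))); last first.
  by move=> y y' x _ _ Gxy Gxy'; apply/(Gpi _ _ Gxy Gxy').
move=> b Bb; apply: contrapT => bG.
have {}bG x : ~ G (x, b).
  by move=> Gxb; apply: bG; exists x => //; have [] := GAB _ Gxb.
have {}aG y : ~ G (a, y) by move=> Gay; apply: aG; exists y.
apply: (Gmax (G `|` [set (a, b)])).
  split; first exact: subsetUl.
  by move=> /(_ (a, b)) Gab; apply: (aG b); apply: Gab; right.
split; last by move=> p [/GAB//|->].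
move=> [x y] [x' y'] [Gp|[-> ->]] [Gq|[-> ->]] //=; first exact: Gpi Gp Gq.
- by split=> [xa|yb]; [case: (aG y); rewrite -xa|case: (bG x); rewrite -yb].
- by split=> [xa|yb]; [case: (aG y'); rewrite xa|case: (bG x'); rewrite yb].
Qed.

Lemma card_ltNge T U (A : set T) (B : set U) : (A #< B) = ~~ (B #<= A).
Proof.
rewrite /card_lt card_eq_le negb_and.
by have := card_le_total A B; case: (A #<= B); case: (B #<= A).
Qed.

Lemma card_eq_setT T (A : set T) : (A #= [set: T]) = ([set: T] #<= A).
Proof. by rewrite card_eq_le card_leT. Qed.

Lemma card_leX T U T' U' (A : set T) (B : set U) (A' : set T') (B' : set U') :
  A #<= A' -> B #<= B' -> A `*` B #<= A' `*` B'.
Proof.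
move=> AA' BB'.
have [[t]|T0] := pselect (inhabited T'); last first.
  have A0 : A = set0.
    apply/(@card_le0P _ T'); apply: card_le_trans AA' (subset_card_le _) => x.
    by case: T0.
  by rewrite A0 set0X; exact: card_ge0.
have [[u]|U0] := pselect (inhabited U'); last first.
  have B0 : B = set0.
    apply/(@card_le0P _ U'); apply: card_le_trans BB' (subset_card_le _) => x.
    by case: U0.
  by rewrite B0 setX0; exact: card_ge0.
have [f fA finj] := card_le_set_inj t AA'.
have [g gB ginj] := card_le_set_inj u BB'.
apply: (@set_inj_card_le _ _ _ _ (fun p => (f p.1, g p.2))).
  by move=> p [/fA ? /gB ?].
move=> [x y] [x' y']; rewrite !inE => -[/= Ax By] [/= Ax' By'] [fE gE].
by congr pair; [apply: finj|apply: ginj]; rewrite ?inE.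
Qed.

(** A sum of two copies of C embeds in C * C as soon as C has two elements. The
bound on the square is an assumption because this lemma is a step in the proof
that infinite sets satisfy it. *)
Lemma card_leU_square T U (A B : set T) (C : set U) :
  infinite_set C -> C `*` C #<= C -> A #<= C -> B #<= C -> A `|` B #<= C.
Proof.
move=> Cinf CC AC BC.
have [c Cc] := infinite_setN0 Cinf.
have boolC : [set: bool] #<= C.
  by apply: card_le_trans (iffLR (infiniteP C) Cinf); apply: countableP.
apply: card_le_trans CC.
apply: card_le_trans (card_leX boolC (card_lexx C)).
have [f fA finj] := card_le_set_inj c AC.
have [g gB ginj] := card_le_set_inj c BC.
apply: (@rel_card_le _ _ _ _ (fun x p =>
   A x /\ p = (true, f x) \/ B x /\ p = (false, g x))).
  by move=> x [Ax|Bx];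
    [exists (true, f x); [split=> //; exact: fA|left]
    |exists (false, g x); [split=> //; exact: gB|right]].
move=> x x' p _ _ [[Ax ->]|[Bx ->]] [[Ax' []]|[Bx' []]] // E.
  by apply: finj; rewrite ?inE.
by apply: ginj; rewrite ?inE.
Qed.

(** * The square of an infinite cardinal *)

(** The graph G of an injection of D * D into D. *)
Definition square_injection T (D : set T) (G : set ((T * T) * T)) :=
  [/\ partial_injection G, G `<=` (D `*` D) `*` D
    & forall p, (D `*` D) p -> exists y, G (p, y)].

(** If G is the graph of a map defined on D * D, this recovers D, so that the
pairs (D, G) can be ordered by inclusion of the graphs alone. *)
Definition diagonal_dom T (G : set ((T * T) * T)) : set T :=
  [set a | exists y, G ((a, a), y)].

(** The pairs of (D + E) * (D + E) that are not in D * D are sent into E, which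
is disjoint from D; so they do not collide with the values of G. *)
Lemma square_injection_extend T (D E : set T) (G : set ((T * T) * T)) :
  square_injection D G -> E `<=` ~` D ->
  (D `|` E) `*` (D `|` E) #<= E -> E !=set0 ->
  exists2 H, G `<` H & square_injection (D `|` E) H.
Proof.
move=> [Gpi GD Dtot] ED /[swap] -[e Ee] /(card_le_set_inj e)[h hE hinj].
pose D' := D `|` E; pose N := [set p | (D' `*` D') p /\ ~ (D `*` D) p].
have N_D' p : N p -> (D' `*` D') p by case.
have GN p q : G p -> N q -> p.1 <> q /\ p.2 <> h q.
  move=> /GD[Dp Dy] [D'q nDq]; split=> [pq|yhq].
    by apply: nDq; rewrite -pq.
  by apply: (ED p.2) => //; rewrite yhq; apply: hE.
exists (G `|` [set (p, h p) | p in N]).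
  split; first exact: subsetUl.
  have D'ee : (D' `*` D') (e, e) by split; right.
  move=> HG; have /GD[_ /=] : G ((e, e), h (e, e)).
    by apply: HG; right; exists (e, e) => //; split=> // -[/ED].
  exact: ED (hE _ D'ee).
split.
- move=> p q [Gp|[p' Np <-]] [Gq|[q' Nq <-]] /=; first exact: Gpi.
  + by have [] := GN _ _ Gp Nq.
  + by have [pq yq] := GN _ _ Gq Np; split=> /esym.
  + by split=> [->//|]; apply: hinj; rewrite inE; apply: N_D'.
- move=> q [/GD[[? ?] ?]|[p Np <-]]; first by do ?split; left.
  by split; [exact: N_D'|right; apply/hE/N_D'].
- move=> p D'p; have [/Dtot[y Gpy]|nDp] := pselect ((D `*` D) p).
    by exists y; left.
  by exists (h p); right; exists p.
Qed.

Lemma square_injection_chain T (F : set (set ((T * T) * T))) :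
  (forall G, F G -> square_injection (diagonal_dom G) G) -> total_on F subset ->
  let G := \bigcup_(G in F) G in square_injection (diagonal_dom G) G.
Proof.
move=> FP tot /=.
have sub G : F G -> diagonal_dom G `<=` diagonal_dom (\bigcup_(H in F) H).
  by move=> FG a [y Gay]; exists y, G.
split.
- by apply: partial_injection_chain => // G /FP[].
- move=> [[a b] y] [G FG Gp]; have [_ GD _] := FP _ FG.
  by have [[/= Da Db] Dy] := GD _ Gp; do ?split; apply: (sub G).
- move=> [a b] /= [[y [G FG Ga]] [z [H FH Hb]]].
  have tot1 K : F K -> diagonal_dom K a -> diagonal_dom K b ->
      exists y, (\bigcup_(H in F) H) ((a, b), y).
    move=> FK Ka Kb; have [_ _ /(_ (a, b))[]// c Kc] := FP _ FK.
    by exists c, K.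
  have [GH|HG] := tot _ _ FG FH.
    by apply: (tot1 H) => //; [exists y; apply: GH|exists z].
  by apply: (tot1 G) => //; [exists y|exists z; apply: HG].
Qed.

(** Take a maximal injection of D * D into D with D included in A. If D is
finite, or if D is infinite and strictly smaller than A, then A \ D contains a
set E, countable in the first case and equipotent to D in the second, such that
(D + E) * (D + E) embeds in E, which contradicts maximality. So D is as large
as A. *)
Theorem card_leX_infinite T (A : set T) : infinite_set A -> A `*` A #<= A.
Proof.
move=> Ainf.
pose P (G : set ((T * T) * T)) :=
  square_injection (diagonal_dom G) G /\ diagonal_dom G `<=` A.
have [F FP tot|G [[sqG GA] Gmax]] := @Zorn_bigcup _ P.
  split; first by apply: square_injection_chain => // G /FP[].
  by move=> a [y [G /FP[_ GA] Ga]]; apply: GA; exists y.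
set D := diagonal_dom G in sqG GA.
have DD : D `*` D #<= D.
  have [Gpi GD Dtot] := sqG.
  apply: (@rel_card_le _ _ _ _ (fun p y => G (p, y))).
    by move=> p /Dtot[y Gpy]; exists y => //; have [] := GD _ Gpy.
  by move=> p q y _ _ Gp Gq; apply/(Gpi _ _ Gp Gq).
have noext E : E `<=` A `\` D -> (D `|` E) `*` (D `|` E) #<= E -> E = set0.
  move=> EAD DE; apply: contrapT => /eqP/set0P E0.
  have ED : E `<=` ~` D by move=> x /EAD[].
  have [H GH sqH] := square_injection_extend sqG ED DE E0.
  have DH : diagonal_dom H = D `|` E.
    have [_ HD Htot] := sqH; apply/seteqP; split=> [a [y /HD[[]]]//|a Da].
    by have [y] := Htot (a, a) (conj Da Da); exists y.
  apply: (Gmax H GH); split; first by rewrite DH.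
  by rewrite DH => x [/GA//|/EAD[]].
have [Dfin|Dinf] := pselect (finite_set D).
  have [s _ _] : exists2 s : nat -> T, True & True.
    by have [a Aa] := infinite_setN0 Ainf; exists (fun=> a).
  have /(card_le_set_inj (s 0))[{}s sAD sinj] : [set: nat] #<= A `\` D.
    by apply/infiniteP; apply: infinite_setD.
  have E0 : range s = set0.
    apply: noext; first by move=> _ [n _ <-]; apply: sAD.
    have natE : range s #= [set: nat] by apply: inj_card_eq.
    have DE_nat : D `|` range s #<= [set: nat].
      apply: card_leU_square.
      - exact: infinite_nat.
      - exact: countableP.
      - exact: finite_set_countable.
      - by rewrite (card_le_eql natE).
    by rewrite (card_le_eqr natE); apply: countableX.
  by have : range s (s 0) by []; rewrite E0.
have [AD|nAD] := boolP (A #<= D).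
  apply: card_le_trans (card_leX AD AD) _.
  exact: card_le_trans DD (subset_card_le GA).
have [d Dd] := infinite_setN0 Dinf.
have [ADD|DAD] := orP (card_le_total (A `\` D) D).
  case/negP: nAD; have -> : A = D `|` (A `\` D) by rewrite setDUK.
  exact: card_leU_square.
have [s sAD sinj] := card_le_set_inj d DAD.
have ED : s @` D #= D by apply: inj_card_eq.
have E0 : s @` D = set0.
  apply: noext; first by move=> _ [x Dx <-]; apply: sAD.
  have DE_D : D `|` s @` D #<= D
    by apply: card_leU_square => //; rewrite (card_le_eql ED).
  rewrite (card_le_eqr ED).
  exact: card_le_trans (card_leX DE_D DE_D) DD.
have : (s @` D) (s d) by exists d.
by rewrite E0.
Qed.

(** * Sets of strictly smaller cardinality *)

Lemma card_leU T U (A B : set T) (C : set U) :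
  infinite_set C -> A #<= C -> B #<= C -> A `|` B #<= C.
Proof. by move=> Cinf; apply: card_leU_square => //; exact: card_leX_infinite. Qed.

Lemma card_le_lt_trans T U V (A : set T) (B : set U) (C : set V) :
  A #<= B -> B #< C -> A #< C.
Proof.
by rewrite !card_ltNge => AB; apply: contra => CA; exact: card_le_trans AB.
Qed.

Lemma finite_card_lt T U (A : set T) (C : set U) :
  finite_set A -> infinite_set C -> A #< C.
Proof.
by rewrite card_ltNge => Afin Cinf; apply/negP => /card_le_finite/(_ Afin).
Qed.

Lemma card_ltU T U (A B : set T) (C : set U) :
  infinite_set C -> A #< C -> B #< C -> A `|` B #< C.
Proof.
move=> Cinf AC BC.
wlog AB : A B AC BC / A #<= B.
  move=> W; have [/W|/W] := orP (card_le_total A B); first exact.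
  by rewrite setUC; exact.
have [Bfin|Binf] := pselect (finite_set B).
  apply: finite_card_lt => //; rewrite finite_setU; split=> //.
  exact: card_le_finite AB Bfin.
by apply: card_le_lt_trans BC; apply: card_leU.
Qed.

Lemma card_ltX T U (A : set T) (C : set U) :
  infinite_set C -> A #< C -> A `*` A #< C.
Proof.
move=> Cinf AC; have [Afin|Ainf] := pselect (finite_set A).
  by apply: finite_card_lt => //; exact: finite_setX.
exact: card_le_lt_trans (card_leX_infinite Ainf) AC.
Qed.

Lemma bigcup_card_leX I U V (D : set I) (F : I -> set U) (N : set V) :
  (forall i, D i -> F i #<= N) -> \bigcup_(i in D) F i #<= D `*` N.
Proof.
move=> FN.
have [[v]|V0] := pselect (inhabited V); last first.
  rewrite (_ : \bigcup_(i in D) F i = set0) ?card_ge0 //.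
  apply: bigcup0 => i /FN Fi; apply/(@card_le0P _ V).
  by apply: card_le_trans Fi (subset_card_le _) => x; case: V0.
have /choice[g gP] i : exists g : U -> V,
    D i -> set_fun (F i) N g /\ set_inj (F i) g.
  have [/FN/(card_le_set_inj v)[g gN ginj]|nD] := pselect (D i); first by exists g.
  by exists (fun=> v).
apply: (@rel_card_le _ _ _ _ (fun x p => [/\ D p.1, F p.1 x & p.2 = g p.1 x])).
  move=> x [i Di Fix]; exists (i, g i x) => //; split=> //=.
  by have [gN _] := gP i Di; apply: gN.
move=> x x' [i y] _ _ [/= Di Fix ->] [/= _ Fix' E].
by have [_ ginj] := gP i Di; apply: ginj; rewrite ?inE.
Qed.

(** * Initial well-orders and cofinality *)

Section WellOrder.
Variables (T : Type) (R : rel T).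
Hypothesis Rwo : well_order R.

Lemma well_order_min (A : set T) :
  A !=set0 -> exists2 m, A m & forall x, A x -> R m x.
Proof.
move=> [a Aa]; have /Rwo[m [[Am mmin] _]] : nonempty (mem A : {pred T}).
  by exists a; apply/mem_set.
by exists m => [|x Ax]; [apply/set_mem|apply/mmin/mem_set].
Qed.

Lemma well_order_anti x y : R x y -> R y x -> x = y.
Proof.
move=> Rxy Ryx; have Rzz z : R z z.
  by have [m -> //] := @well_order_min [set z] (ex_intro _ z erefl); apply.
have /Rwo[m [_ muniq]] : nonempty (mem [set x; y] : {pred T}).
  by exists x; apply/mem_set; left.
have <- : m = x.
  by apply: muniq; split; [apply/mem_set; left|move=> z /set_mem[->|->]].
by apply: muniq; split; [apply/mem_set; right|move=> z /set_mem[->|->]].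
Qed.

Lemma well_order_total x y : R x y \/ R y x.
Proof.
have [|m [->|->] mmin] := @well_order_min [set x; y]; first by exists x; left.
  by left; apply: mmin; right.
by right; apply: mmin; left.
Qed.

Lemma well_order_trans y x z : R x y -> R y z -> R x z.
Proof.
move=> Rxy Ryz.
have [|m Am mmin] := @well_order_min [set t | [\/ t = x, t = y | t = z]].
  by exists x; constructor 1.
have mx : R m x by apply: mmin; constructor 1.
have my : R m y by apply: mmin; constructor 2.
have mz : R m z by apply: mmin; constructor 3.
case: Am => mE; rewrite mE in mx my mz => //.
  by rewrite (well_order_anti Rxy mx).
by rewrite -(well_order_anti Ryz my).
Qed.

Lemma well_order_wf : well_founded (fun x y => R x y /\ x <> y).
Proof.
move=> x; apply: contrapT => nAx.
have [|m nAm mmin] := @well_order_min [set x | ~ Acc (fun x y => R x y /\ x <> y) x].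
  by exists x.
apply: nAm; constructor => y [Rym ym]; apply: contrapT => nAy.
by apply: ym; apply: well_order_anti => //; apply: mmin.
Qed.

End WellOrder.

(** If a well-order has full proper initial segments, let x be the least
element whose segment is full and pull the order back along an injection h of
T into that segment: every segment of the new order embeds in the segment of
some h(a), which lies below x. *)
Lemma initial_well_order_exists T : exists R : rel T, initial_well_order R.
Proof.
have [R0 R0wo] : exists R : rel T, well_order R.
  by elim/Peq: T => T; have [R Rwo] := @well_ordering_principle T; exists R.
pose seg x := [set y | R0 y x /\ y <> x].
have [small|] := pselect (forall x, seg x #< [set: T]); first by exists R0.
move=> /existsNP[x0 /negP x0big].
have [|x /negP xbig xmin] := well_order_min R0wo (A := [set x | ~ (seg x #< [set: T])]).
  by exists x0; apply/negP.
move: xbig; rewrite card_ltNge negbK => /(card_le_set_inj x)[h hx hinj].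
exists (fun a b => R0 (h a) (h b)); split.
  have {}hinj a b : h a = h b -> a = b by apply: hinj; rewrite inE.
  move=> A [a Aa].
  have [|m [b Ab <-] mmin] := well_order_min R0wo (A := h @` [set` A]).
    by exists (h a), a.
  exists b; split=> [|c [Ac cmin]].
    by split=> // y Ay; apply: mmin; exists y.
  by apply/hinj/(well_order_anti R0wo); [apply: mmin; exists c|apply: cmin].
move=> a; have [Rhx hax] := hx a I.
have segh : seg (h a) #< [set: T].
  apply: contrapT => big; apply: hax; apply: (well_order_anti R0wo) => //.
  exact: xmin.
apply: card_le_lt_trans segh; apply: (@set_inj_card_le _ _ _ _ h).
  by move=> y [Ry ya]; split=> // /(hinj _ _ (mem_set I) (mem_set I)).
by move=> y z _ _; apply: hinj; rewrite inE.
Qed.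

Section Cofinality.
Variable T : Type.
Hypothesis Tinf : infinite_set [set: T].

Lemma initial_seg_card_lt (R : rel T) x :
  initial_well_order R -> [set y | R y x] #< [set: T].
Proof.
move=> [Rwo Rini].
apply: (@card_le_lt_trans _ _ _ _ ([set y | R y x /\ y <> x] `|` [set x])).
  by apply: subset_card_le => y Ryx; have [->|yx] := pselect (y = x); [right|left].
by apply: card_ltU => //; apply: finite_card_lt.
Qed.

(** By regularity a small set is bounded in the initial order. So each F(i) has
a bound, the set of these bounds is small and hence bounded in turn, and the
union lies in a single initial segment. *)
Lemma regular_bigcup_card_lt (D : set T) (F : T -> set T) :
  regular_card T -> D #< [set: T] -> (forall i, D i -> F i #< [set: T]) ->
  \bigcup_(i in D) F i #< [set: T].
Proof.
move=> [_ [R Rini Rreg]] Dsmall Fsmall; have [Rwo _] := Rini.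
have bounded A : A #< [set: T] -> exists x, A `<=` [set y | R y x].
  rewrite card_ltNge -card_eq_setT => /negP nA; apply: contrapT => unbounded.
  apply: nA; apply: Rreg => x; apply: contrapT => nAx; apply: unbounded.
  exists x => y Ay /=; have [Rxy|//] := well_order_total Rwo x y.
  by case: nAx; exists y.
have [[i0 Di0]|D0] := pselect (D !=set0); last first.
  apply: finite_card_lt => //; rewrite bigcup0 // => i Di.
  by case: D0; exists i.
have /choice[b bP] i : exists x, D i -> F i `<=` [set y | R y x].
  have [/Fsmall/bounded[x Fx]|nDi] := pselect (D i); first by exists x.
  by exists i0.
have [x bx] : exists x, b @` D `<=` [set y | R y x].
  by apply/bounded/card_le_lt_trans/Dsmall/card_image_le.
apply: card_le_lt_trans (initial_seg_card_lt x Rini).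
apply: subset_card_le => y [i Di Fiy]; apply: (well_order_trans Rwo (y := b i)).
  exact: bP Fiy.
by apply: bx; exists i.
Qed.

Lemma singular_small_cofinal : singular_card T ->
  exists (R : rel T) (C : set T),
    [/\ initial_well_order R, cofinal R C & C #< [set: T]].
Proof.
move=> [_ nreg]; have [R Rini] := initial_well_order_exists T.
have [C /not_implyP[Ccof nC]] : exists C : set T, ~ (cofinal R C -> C #= [set: T]).
  by apply/existsNP => Creg; apply: nreg; split=> //; exists R.
by exists R, C; split=> //; rewrite card_ltNge -card_eq_setT; apply/negP.
Qed.

(** Successor cardinals are regular: if all small sets had size at most N, a
small cofinal set would cover T by at most N segments of size at most N. *)
Lemma singular_card_limit V (N : set V) : singular_card T -> N #< [set: T] ->
  exists2 M : set T, M #< [set: T] & ~~ (M #<= N).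
Proof.
move=> /singular_small_cofinal[R [C [Rini Ccof Csmall]]] Nsmall.
apply: contrapT => noM.
have leN (M : set T) : M #< [set: T] -> M #<= N.
  by move=> Msmall; apply/negPn/negP => MN; apply: noM; exists M.
have : [set: T] #<= N `*` N.
  apply: (@card_le_trans _ _ _ (\bigcup_(c in C) [set y | R y c])).
    by apply: subset_card_le => x _; have [c Cc Rxc] := Ccof x; exists c.
  apply: card_le_trans (card_leX (leN _ Csmall) (card_lexx N)).
  by apply: bigcup_card_leX => c _; apply/leN/initial_seg_card_lt.
by apply/negP; rewrite -card_ltNge; exact: card_ltX.
Qed.

End Cofinality.

(** * Permutations with prescribed targets *)

Section Moieties.
Variable T : Type.
Hypothesis Tinf : infinite_set [set: T].

Lemma another_point (t : T) : exists t', t' <> t.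
Proof.
apply: contrapT => alone; apply: Tinf; apply: sub_finite_set (finite_set1 t) => x _.
by apply: contrapT => xt; apply: alone; exists x.
Qed.

Lemma pairing_exists : exists j : T * T -> T, injective j.
Proof.
have [t _] := infinite_setN0 Tinf.
have [j _ jinj] := card_le_set_inj t (card_leX_infinite Tinf).
by exists j => p q; apply: jinj; rewrite inE.
Qed.

Lemma full_injection U (f : U -> T) (A : set T) :
  [set: T] #<= [set: U] -> injective f -> (forall x, A (f x)) -> [set: T] #<= A.
Proof.
move=> TU finj fA; apply: card_le_trans TU _.
by apply: (@set_inj_card_le _ _ _ _ f) => [x _|x y _ _]; [exact: fA|exact: finj].
Qed.

(** Transfinite recursion along an initial well-order: when e(x) is to be
chosen, fewer than |T| values are already used, so F(x) contains a fresh
point. *)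
Lemma injective_choice_self (F : T -> set T) :
  (forall x, [set: T] #<= F x) ->
  exists2 e : T -> T, injective e & forall x, F x (e x).
Proof.
move=> Fbig.
have [R [Rwo Rini]] := initial_well_order_exists T.
pose lt x y := R x y /\ x <> y.
have lt_wf : well_founded lt := well_order_wf Rwo.
have fresh x (e : forall y, lt y x -> T) :
    exists p, F x p /\ forall y (yx : lt y x), e y yx <> p.
  apply: contrapT => nofresh.
  pose used := [set p | exists y (yx : lt y x), e y yx = p].
  have Fused : F x `<=` used.
    move=> p Fxp; apply: contrapT => np; apply: nofresh; exists p; split=> // y yx ep.
    by apply: np; exists y, yx.
  have : used #< [set: T].
    apply: card_le_lt_trans (Rini x).
    apply: (@rel_card_le _ _ _ _ (fun p y => exists yx : lt y x, e y yx = p)).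
      by move=> p [y [yx ep]]; exists y => //; exists yx.
    move=> p q y _ _ [yx <-] [yx' <-]; congr (e y _); exact: Prop_irrelevance.
  by rewrite card_ltNge (card_le_trans (Fbig x) (subset_card_le Fused)).
pose step x e := projT1 (cid (fresh x e)).
pose e := Fix lt_wf (fun=> T) step.
have eE x : e x = step x (fun y _ => e y).
  apply: Fix_eq => z f g fg; congr (step z).
  by apply: functional_extensionality_dep => y; apply/funext.
have eP x : F x (e x) /\ forall y, lt y x -> e y <> e x.
  have [Fp pfresh] := projT2 (cid (fresh x (fun y _ => e y))).
  by rewrite [e x]eE.
exists e => [x y exy|x]; last by case: (eP x).
apply: contrapT => xy; have [Rxy|Ryx] := well_order_total Rwo x y.
  by have [_ /(_ x)] := eP y; apply.
by have [_ /(_ y)] := eP x; apply=> //; split=> // yx; apply: xy.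
Qed.

(** The complement of the range is kept full by choosing distinct values for
the whole of T * T and retaining those at the pairs (i(x), t); the values at the
pairs (y, t'), for a fixed t' other than t, are then avoided. *)
Lemma injective_choice U (i : U -> T) (F : U -> set T) :
  injective i -> (forall x, [set: T] #<= F x) ->
  exists e : U -> T,
    [/\ injective e, forall x, F x (e x) & [set: T] #<= ~` range e].
Proof.
move=> iinj Fbig; have [j jinj] := pairing_exists.
have [t _] := infinite_setN0 Tinf; have [t' tt'] := another_point t.
(* Off the points j (i x, t) the condition is void. *)
pose F' y := [set p | forall x, y = j (i x, t) -> F x p].
have F'big y : [set: T] #<= F' y.
  have [[x ->]|nx] := pselect (exists x, y = j (i x, t)).
    apply: card_le_trans (Fbig x) (subset_card_le _) => p Fxp z.
    by move=> /jinj[/iinj <-].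
  by apply: subset_card_le => p _ x yx; case: nx; exists x.
have [e einj eF] := injective_choice_self F'big.
exists (fun x => e (j (i x, t))); split.
- by move=> x y /einj/jinj[/iinj].
- by move=> x; apply: (eF (j (i x, t))).
- apply: (@full_injection _ (fun x => e (j (x, t')))) => //.
    by move=> x y /einj/jinj[].
  by move=> x [y _ /einj/jinj[_ /esym]].
Qed.

Lemma permutation_extension U (i k : U -> T) :
  injective i -> injective k ->
  [set: T] #<= ~` range i -> [set: T] #<= ~` range k ->
  exists2 q : T -> T, bijective q & forall x, q (i x) = k x.
Proof.
move=> iinj kinj ibig kbig; have [t _] := infinite_setN0 Tinf.
have [h [hfun hinj hsurj]] : exists h, set_bij (~` range i) (~` range k) h.
  have : ~` range i #= ~` range k.
    rewrite card_eq_le; apply/andP; split.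
      exact: card_le_trans (card_leT _) kbig.
    exact: card_le_trans (card_leT _) ibig.
  by move=> /(card_eq_set_bij t).
have /choice[q qP] y : exists z,
    (forall x, y = i x -> z = k x) /\ ((~` range i) y -> z = h y).
  have [[x _ <-]|ny] := pselect (range i y).
    by exists (k x); split=> [x' /iinj ->//|[]]; exists x.
  by exists (h y); split=> // x yx; case: ny; exists x.
have qi x : q (i x) = k x by have [qk _] := qP (i x); exact: qk.
have qh y : (~` range i) y -> q y = h y by have [_] := qP y.
exists q => //; rewrite -setTT_bijective; split=> //.
  move=> y z _ _; have [[x _ <-]|ny] := pselect (range i y);
    have [[x' _ <-]|nz] := pselect (range i z).
  - by rewrite !qi => /kinj ->.
  - by rewrite qi qh // => kh; case: (hfun z nz); exists x.
  - by rewrite qi qh // => kh; case: (hfun y ny); exists x'.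
  - by rewrite !qh //; apply: hinj; rewrite inE.
move=> y _; have [[x _ <-]|ny] := pselect (range k y).
  by exists (i x).
by have [z nz <-] := hsurj y ny; exists z => //; rewrite qh.
Qed.

Lemma permutation_into U (i : U -> T) (F : U -> set T) :
  injective i -> [set: T] #<= ~` range i -> (forall x, [set: T] #<= F x) ->
  exists2 q : T -> T, bijective q & forall x, F x (q (i x)).
Proof.
move=> iinj ibig Fbig.
have [e [einj eF ebig]] := injective_choice iinj Fbig.
have [q qbij qi] := permutation_extension iinj einj ibig ebig.
by exists q => // x; rewrite qi.
Qed.

End Moieties.

(** * Closed classes of maps *)

Section Semigroup.
Variable T : Type.
Hypothesis Tinf : infinite_set [set: T].
Implicit Types (u v h k : T -> T) (F S : set (T -> T)).

Lemma semigroup_gen_sub F S :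
  subsemigroup S -> F `<=` S -> semigroup_gen F `<=` S.
Proof. exact: smallest_sub. Qed.

Lemma semigroup_gen_id F : F `<=` semigroup_gen F.
Proof. exact: sub_gen_smallest. Qed.

Lemma semigroup_gen_comp F : subsemigroup (semigroup_gen F).
Proof.
by move=> h k Fh Fk S SS; have [Ssub FS] := SS; apply: Ssub; [apply: Fh|apply: Fk].
Qed.

Lemma comp_fibre h k a :
  (h \; k) @^-1` [set a] = \bigcup_(b in k @^-1` [set a]) h @^-1` [set b].
Proof.
by apply/seteqP; split=> [x /= hx|x [b /= <- <-]//]; exists (h x).
Qed.

(** If [h \; k] is injective then so is h; within this class h is then bijective,
and therefore k is injective, hence bijective, too. *)
Lemma bij_or_not_inj_subsemigroup :
  subsemigroup [set h : T -> T | bijective h \/ ~ injective h].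
Proof.
move=> h k [hbij|hninj]; last first.
  by right=> hkinj; apply: hninj => x y hxy; apply: hkinj; rewrite /= hxy.
move=> [kbij|kninj]; [by left; exact: bij_comp|right=> hkinj].
have [h' hK h'K] := hbij; apply: kninj => x y kxy.
by rewrite -(h'K x) -(h'K y); congr h; apply: hkinj; rewrite /= !h'K.
Qed.

(** If [h \; k] is onto then so is k; within this class k is then bijective, and
therefore h is onto, hence bijective, too. *)
Lemma bij_or_not_surj_subsemigroup :
  subsemigroup [set h : T -> T | bijective h \/ range h <> [set: T]].
Proof.
move=> h k + [kbij|knsurj]; last first.
  move=> _; right=> hksurj; apply: knsurj; apply/seteqP; split=> // y _.
  by have [x _ <-] : range (h \; k) y by [rewrite hksurj]; exists (h x).
move=> [hbij|hnsurj]; [by left; exact: bij_comp|right=> hksurj].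
have [k' kK k'K] := kbij; apply: hnsurj; apply/seteqP; split=> // y _.
have [x _ /= hkx] : range (h \; k) (k y) by rewrite hksurj.
by exists x => //; rewrite -(kK y) -hkx kK.
Qed.

Lemma small_defect_subsemigroup :
  subsemigroup [set h : T -> T | defect h #< [set: T]].
Proof.
move=> h k /= hsmall ksmall.
apply: (@card_le_lt_trans _ _ _ _ (defect k `|` k @` defect h)); last first.
  by apply: card_ltU => //; apply: card_le_lt_trans hsmall; exact: card_image_le.
apply: subset_card_le => y nhk.
have [[x _ kxy]|ny] := pselect (range k y); [right|by left].
by exists x => // -[z _ hzx]; apply: nhk; exists z => //=; rewrite hzx.
Qed.

(** Transfers a statement about single fibres to the sets of large fibres: the
points with a large fibre under [h \; k] then lie in the union of
[large_fibres k A] and the image under k of [large_fibres h B]. *)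
Lemma large_fibres_comp U V W (A : set U) (B : set V) (C : set W) h k :
  (forall a, ~~ (A #<= k @^-1` [set a]) ->
     (forall b, k b = a -> ~~ (B #<= h @^-1` [set b])) ->
     ~~ (C #<= (h \; k) @^-1` [set a])) ->
  large_fibres k A #< [set: T] -> large_fibres h B #< [set: T] ->
  large_fibres (h \; k) C #< [set: T].
Proof.
move=> small ksmall hsmall.
apply: (@card_le_lt_trans _ _ _ _ (large_fibres k A `|` k @` large_fibres h B)).
  apply: subset_card_le => a /= Ca; apply: contrapT => /not_orP[nka nha].
  suff /negP : ~~ (C #<= (h \; k) @^-1` [set a]) by [].
  apply: small; first exact/negP.
  by move=> b kba; apply/negP => hb; apply: nha; exists b.
by apply: card_ltU => //; apply: card_le_lt_trans hsmall; exact: card_image_le.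
Qed.

Lemma regular_small_large_fibres_subsemigroup : regular_card T ->
  subsemigroup [set h : T -> T | large_fibres h [set: T] #< [set: T]].
Proof.
move=> Treg h k /= hsmall ksmall; apply: large_fibres_comp ksmall hsmall => a.
rewrite -!card_ltNge comp_fibre => ka hb.
by apply: regular_bigcup_card_lt => // b /hb; rewrite -card_ltNge.
Qed.

Lemma singular_small_large_fibres_subsemigroup : singular_card T ->
  subsemigroup [set h : T -> T |
    exists2 N : set T, N #< [set: T] & large_fibres h N #< [set: T]].
Proof.
move=> Tsing h k [N Nsmall hN] [N' N'small kN'].
have NNsmall : (N `|` N') `*` (N `|` N') #< [set: T].
  by apply: card_ltX => //; exact: card_ltU.
have [M Msmall MNN] := singular_card_limit Tinf Tsing NNsmall.
exists M => //; apply: large_fibres_comp kN' hN => a; rewrite -!card_ltNge.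
move=> /andP[ka _] hb; rewrite card_ltNge comp_fibre.
apply: contra MNN => /card_le_trans; apply.
have kaN : k @^-1` [set a] #<= N `|` N'.
  by apply: card_le_trans ka (subset_card_le _); exact: subsetUr.
apply: card_le_trans (card_leX kaN (card_lexx _)).
apply: bigcup_card_leX => b /hb; rewrite -card_ltNge => /andP[hbN _].
by apply: card_le_trans hbN (subset_card_le _); exact: subsetUl.
Qed.

Lemma injective_large_fibres U h (A : set U) x y :
  injective h -> A x -> A y -> x <> y -> large_fibres h A = set0.
Proof.
move=> hinj Ax Ay xy; apply/seteqP; split=> // a /=.
have [t _] := infinite_setN0 Tinf.
move=> /(card_le_set_inj t)[e eA einj]; apply: xy; apply: einj; rewrite ?inE//.
by apply: hinj; rewrite (eA _ Ax) (eA _ Ay).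
Qed.

(** The first projection of T * T, transported to T. *)
Lemma full_fibre_map_exists :
  exists v, forall a, [set: T] #<= v @^-1` [set a].
Proof.
have [j jinj] := pairing_exists Tinf; have [t _] := infinite_setN0 Tinf.
have /choice[p pj] y : exists z, forall q, y = j q -> z = q.1.
  have [[q _ <-]|ny] := pselect (range j y); first by exists q.1 => q' /jinj ->.
  by exists t => q yq; case: ny; exists q.
exists p => a; apply: (@full_injection _ _ (fun b => j (a, b))) => //.
  by move=> b c /jinj[].
by move=> b; exact: (pj _ (a, b)).
Qed.

Lemma injective_nonsurjective_exists :
  exists2 h : T -> T, injective h & range h <> [set: T].
Proof.
have [j jinj] := pairing_exists Tinf; have [t _] := infinite_setN0 Tinf.
have [t' tt'] := another_point Tinf t.
exists (fun x => j (x, t)) => [x y /jinj[]//|E].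
by have [x _ /jinj[_ /esym]] : range (fun x => j (x, t)) (j (t, t')) by rewrite E.
Qed.

(** * Necessity *)

Section Necessity.
Variables f g : T -> T.
Hypothesis gen : semigroup_gen (Sym T `|` [set f; g]) = [set: T -> T].

Lemma generation_ind S : subsemigroup S -> Sym T `<=` S -> S f -> S g ->
  forall h, S h.
Proof.
move=> Ssub symS Sf Sg h.
have : semigroup_gen (Sym T `|` [set f; g]) h by rewrite gen.
by apply: semigroup_gen_sub h => // h [/symS//|[->|->]].
Qed.

Lemma generator_inj_nonbij :
  (injective f /\ ~ bijective f) \/ (injective g /\ ~ bijective g).
Proof.
apply: contrapT => /not_orP[/not_andP nf /not_andP ng].
have [h hinj hnsurj] := injective_nonsurjective_exists.
have [|||hbij|//] := generation_ind bij_or_not_inj_subsemigroup _ _ _ h.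
- by left.
- by case: nf => [|/contrapT]; [right|left].
- by case: ng => [|/contrapT]; [right|left].
by move: hbij; rewrite -setTT_bijective => -[_ _ hsurj]; apply/hnsurj/seteqP.
Qed.

Lemma generator_surj_nonbij :
  (range f = [set: T] /\ ~ bijective f) \/ (range g = [set: T] /\ ~ bijective g).
Proof.
apply: contrapT => /not_orP[/not_andP nf /not_andP ng].
have [v vfull] := full_fibre_map_exists; have [t _] := infinite_setN0 Tinf.
have [t' tt'] := another_point Tinf t.
have [|||vbij|] := generation_ind bij_or_not_surj_subsemigroup _ _ _ v.
- by left.
- by case: nf => [|/contrapT]; [right|left].
- by case: ng => [|/contrapT]; [right|left].
- have [e ea einj] := card_le_set_inj t (vfull t).
  apply: tt'; apply: einj; rewrite ?inE //; apply: (bij_inj vbij).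
  by rewrite (ea t I) (ea t' I).
- move=> []; apply/seteqP; split=> // a _.
  have [e ea _] := card_le_set_inj t (vfull a).
  by exists (e t) => //; apply: ea.
Qed.

Hypothesis finj : injective f.
Hypothesis gsurj : range g = [set: T].

(** A constant map has full defect. *)
Lemma generator_full_defect : defect f #= [set: T].
Proof.
rewrite card_eq_setT; apply/negPn/negP; rewrite -card_ltNge => fsmall.
have [t _] := infinite_setN0 Tinf.
have surj_small h : range h = [set: T] -> defect h #< [set: T].
  by rewrite /defect => ->; rewrite setCT; apply: finite_card_lt.
have /= := generation_ind small_defect_subsemigroup _ fsmall
  (surj_small g gsurj) (fun=> t).
have -> : defect (fun=> t) = ~` [set t].
  by congr setC; apply/seteqP; split=> [_ [_ _ <-]//|_ ->]; exists t.
have /[swap]/[apply] : Sym T `<=` [set h | defect h #< [set: T]].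
  by move=> h; rewrite /Sym /= -setTT_bijective => -[_ _ hsurj]; apply/surj_small/seteqP.
move=> tsmall.
have : [set t] `|` ~` [set t] #< [set: T].
  by apply: card_ltU => //; apply: finite_card_lt.
by rewrite setUv card_ltNge card_lexx.
Qed.

Lemma generator_large_fibres_regular :
  regular_card T -> large_fibres g [set: T] #= [set: T].
Proof.
move=> Treg; rewrite card_eq_setT; apply/negPn/negP; rewrite -card_ltNge => gsmall.
have [t _] := infinite_setN0 Tinf; have [t' tt'] := another_point Tinf t.
have inj_small h : injective h -> large_fibres h [set: T] #< [set: T].
  by move=> hinj; rewrite (injective_large_fibres hinj _ _ tt') //; apply: finite_card_lt.
have [v vfull] := full_fibre_map_exists.
have := generation_ind (regular_small_large_fibres_subsemigroup Treg)
  (fun h hbij => inj_small h (bij_inj hbij)) (inj_small f finj) gsmall v.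
rewrite /= card_ltNge (_ : large_fibres v _ = [set: T]) ?card_lexx //.
by apply/seteqP; split=> // a _; apply: vfull.
Qed.

Lemma generator_large_fibres_singular (N : set T) :
  singular_card T -> N #< [set: T] -> large_fibres g N #= [set: T].
Proof.
move=> Tsing Nsmall; rewrite card_eq_setT; apply/negPn/negP.
rewrite -card_ltNge => gsmall.
have [t _] := infinite_setN0 Tinf; have [t' tt'] := another_point Tinf t.
pose S := [set h : T -> T |
  exists2 N : set T, N #< [set: T] & large_fibres h N #< [set: T]].
have inj_small h : injective h -> S h.
  move=> hinj; exists [set t; t']; first exact: finite_card_lt.
  rewrite (injective_large_fibres (x := t') (y := t) hinj) //; last by left.
    exact: finite_card_lt.
  by right.
have [v vfull] := full_fibre_map_exists.
have [|M _] := generation_ind (singular_small_large_fibres_subsemigroup Tsing)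
  (fun h hbij => inj_small h (bij_inj hbij)) (inj_small f finj) _ v.
  by exists N.
rewrite card_ltNge (_ : large_fibres v _ = [set: T]) ?card_lexx //.
by apply/seteqP; split=> // a _; apply: card_le_trans (card_leT _) (vfull a).
Qed.

End Necessity.

(** * Sufficiency *)

(** Let s be a section of v. The inverse p of q sends each s(a) to a point whose
fibre under v is full, and that fibre lies in the fibre of the product over a.
The complement of the range of s is full because it contains a full fibre of v
up to one point. *)
Lemma full_fibre_product v : range v = [set: T] ->
  large_fibres v [set: T] #= [set: T] ->
  exists2 q : T -> T, bijective q &
    forall a, [set: T] #<= (v \; q \; v) @^-1` [set a].
Proof.
rewrite card_eq_setT => vsurj vlarge.
have /choice[s sK] a : exists x, v x = a.
  by have [x _ <-] : range v a; [rewrite vsurj|exists x].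
have sinj : injective s by move=> a b sab; rewrite -(sK a) sab sK.
have [t _] := infinite_setN0 Tinf.
have scobig : [set: T] #<= ~` range s.
  have [e ev _] := card_le_set_inj t vlarge.
  have fib := ev t I; set a := e t in fib.
  apply/negPn; rewrite -card_ltNge; apply/negP => small.
  have : v @^-1` [set a] #< [set: T].
    apply: (@card_le_lt_trans _ _ _ _ (~` range s `|` [set s a])).
      apply: subset_card_le => x /= vx; have [[b _ sb]|nx] := pselect (range s x).
        by right; rewrite -vx -sb sK.
      by left.
    by apply: card_ltU => //; apply: finite_card_lt.
  by rewrite card_ltNge fib.
have [p [q pK qK] pv] := permutation_into Tinf sinj scobig (fun=> vlarge).
exists q; first by exists p.
move=> a; apply: card_le_trans (pv a) (subset_card_le _) => x /= vx.
by rewrite vx pK sK.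
Qed.

(** Let C be small and cofinal, and for |T| points a with a fibre of size at
least |C| pick distinct points i(a, c) of that fibre. If the inverse of q sends
i(a, c) to a point whose fibre is at least as large as the segment up to c, the
fibre of the product over a contains disjoint copies of all these segments.
Choosing for each y an element c of C above it and placing y in the copy of its
segment embeds T in that fibre. *)
Lemma singular_large_product v : range v = [set: T] -> singular_card T ->
  (forall N : set T, N #< [set: T] -> large_fibres v N #= [set: T]) ->
  exists2 q : T -> T, bijective q &
    large_fibres (v \; q \; v) [set: T] #= [set: T].
Proof.
move=> vsurj Tsing vlarge.
have [t _] := infinite_setN0 Tinf; have [t' tt'] := another_point Tinf t.
have [R [C [Rini Ccof Csmall]]] := singular_small_cofinal Tinf Tsing.
have [j jinj] := pairing_exists Tinf.
have [l lC linj] : exists2 l : T -> T,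
    set_fun [set: T] (large_fibres v C) l & set_inj [set: T] l.
  by apply: (card_le_set_inj t); rewrite -card_eq_setT; exact: vlarge.
have {}linj x y : l x = l y -> x = y by apply: linj; rewrite inE.
have /choice[e eP] x : exists e : T -> T,
    (forall c, C c -> v (e c) = l x) /\ set_inj C e.
  by have [e] := card_le_set_inj t (lC x I); exists e.
(* The points over l (j (x, t')) stay outside the range of i, which makes its
   complement full. *)
pose i (p : T * {c | C c}) := e (j (p.1, t)) (sval p.2).
have vi p : v (i p) = l (j (p.1, t)).
  by have [-> //] := eP (j (p.1, t)); apply: (svalP p.2).
have iinj : injective i.
  move=> [x [c Cc]] [y [d Cd]] E.
  have xy : x = y by have := congr1 v E; rewrite !vi => /linj/jinj[].
  subst y; congr pair; apply: eq_exist.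
  by have [_] := eP (j (x, t)); apply; rewrite ?inE.
have icobig : [set: T] #<= ~` range i.
  have [c Cc _] := Ccof t.
  have ve x : v (e (j (x, t')) c) = l (j (x, t')) by have [-> //] := eP (j (x, t')).
  apply: (@full_injection _ _ (fun x => e (j (x, t')) c)) => //.
    by move=> x y /(congr1 v); rewrite !ve => /linj/jinj[].
  by move=> x [p _ /(congr1 v)]; rewrite vi ve => /linj/jinj[_ /esym].
pose F (p : T * {c | C c}) := large_fibres v [set y | R y (sval p.2)].
have Fbig p : [set: T] #<= F p.
  by rewrite -card_eq_setT; apply: vlarge; exact: initial_seg_card_lt.
have [p [q pK qK] pF] := permutation_into Tinf iinj icobig Fbig.
exists q; first by exists p.
rewrite card_eq_setT; apply: (@full_injection _ _ (fun x => l (j (x, t)))) => //.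
  by move=> x y /linj/jinj[].
move=> x.
have /choice[c cP] y : exists c : {c | C c}, R y (sval c).
  by have [c Cc Ryc] := Ccof y; exists (exist _ c Cc).
have /choice[m mP] (d : {c | C c}) : exists m : T -> T,
    set_fun [set y | R y (sval d)] (v @^-1` [set p (i (x, d))]) m /\
    set_inj [set y | R y (sval d)] m.
  by have [m] := card_le_set_inj t (pF (x, d)); exists m.
have vm y : v (m (c y) y) = p (i (x, c y)) by have [mv _] := mP (c y); apply: mv (cP y).
apply: (@full_injection _ _ (fun y => m (c y) y)) => //.
  move=> y z E; have := congr1 v E; rewrite !vm => /(can_inj pK)/iinj[cyz].
  have [_ minj] := mP (c y); apply: minj; rewrite ?inE /=; first exact: cP.
    by rewrite cyz; exact: cP.
  by rewrite E cyz.
by move=> y /=; rewrite vm pK vi.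
Qed.

(** It suffices that q send u(x) into the fibre of v over h(x). *)
Lemma factor_through_full_fibres u v : injective u -> defect u #= [set: T] ->
  (forall a, [set: T] #<= v @^-1` [set a]) ->
  forall h, exists2 q : T -> T, bijective q & h = u \; q \; v.
Proof.
rewrite card_eq_setT => uinj ubig vfull h.
have [q qbij qv] := permutation_into Tinf uinj ubig (fun x => vfull (h x)).
by exists q => //; apply/funext => x; rewrite -[LHS](qv x).
Qed.

Lemma full_large_fibres_sufficient u v : injective u -> defect u #= [set: T] ->
  range v = [set: T] -> large_fibres v [set: T] #= [set: T] ->
  semigroup_gen (Sym T `|` [set u; v]) = [set: T -> T].
Proof.
move=> uinj ubig vsurj vlarge; apply/seteqP; split=> // h _.
have [q qbij qfull] := full_fibre_product vsurj vlarge.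
have [p pbij ->] := factor_through_full_fibres uinj ubig qfull h.
have genu : semigroup_gen (Sym T `|` [set u; v]) u.
  by apply: semigroup_gen_id; right; left.
have genv : semigroup_gen (Sym T `|` [set u; v]) v.
  by apply: semigroup_gen_id; right; right.
have gensym k : bijective k -> semigroup_gen (Sym T `|` [set u; v]) k.
  by move=> kbij; apply: semigroup_gen_id; left.
have gcomp := @semigroup_gen_comp (Sym T `|` [set u; v]).
exact: gcomp (gcomp _ _ genu (gensym p pbij))
             (gcomp _ _ (gcomp _ _ genv (gensym q qbij)) genv).
Qed.

Lemma sufficiency u v : injective u -> defect u #= [set: T] ->
  range v = [set: T] ->
  (regular_card T /\ large_fibres v [set: T] #= [set: T]) \/
  (singular_card T /\ forall N : set T, N #< [set: T] ->
     large_fibres v N #= [set: T]) ->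
  semigroup_gen (Sym T `|` [set u; v]) = [set: T -> T].
Proof.
move=> uinj ubig vsurj [[_ vlarge]|[Tsing vlarge]]; first exact:
  full_large_fibres_sufficient.
have [q qbij wlarge] := singular_large_product vsurj Tsing vlarge.
set w := v \; q \; v in wlarge.
have wsurj : range w = [set: T].
  have [q' qK q'K] := qbij; apply/seteqP; split=> // y _.
  have [x _ <-] : range v y by rewrite vsurj.
  have [z _ zx] : range v (q' x) by rewrite vsurj.
  by exists z => //; rewrite /w /= zx q'K.
apply/seteqP; split=> //; rewrite
  -(full_large_fibres_sufficient uinj ubig wsurj wlarge).
apply: semigroup_gen_sub; first exact: semigroup_gen_comp.
move=> k [kbij|[->|->]]; first by apply: semigroup_gen_id; left.
  by apply: semigroup_gen_id; right; left.
have genv : semigroup_gen (Sym T `|` [set u; v]) v.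
  by apply: semigroup_gen_id; right; right.
have genq : semigroup_gen (Sym T `|` [set u; v]) q.
  by apply: semigroup_gen_id; left.
have gcomp := @semigroup_gen_comp (Sym T `|` [set u; v]).
exact: gcomp (gcomp _ _ genv genq) genv.
Qed.

Lemma necessity f g : semigroup_gen (Sym T `|` [set f; g]) = [set: T -> T] ->
  injective f -> range g = [set: T] ->
  defect f #= [set: T] /\
  ((regular_card T /\ large_fibres g [set: T] #= [set: T]) \/
   (singular_card T /\ forall N : set T, N #< [set: T] ->
      large_fibres g N #= [set: T])).
Proof.
move=> gen finj gsurj; split; first exact: generator_full_defect gen gsurj.
have [Treg|Tnreg] := pselect (regular_card T); [left|right]; split=> //.
  exact: generator_large_fibres_regular gen finj Treg.
move=> N Nsmall; have Tsing : singular_card T by [].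
exact: generator_large_fibres_singular gen finj _ Tsing Nsmall.
Qed.

End Semigroup.

Theorem corollary4p2 (Omega : Type) (infOmega : infinite_set [set: Omega])
    (f g : Omega -> Omega) :
  let good (u v : Omega -> Omega) :=
    [/\ injective u,
        defect u #= [set: Omega],
        range v = [set: Omega] &
        (regular_card Omega /\
           large_fibres v [set: Omega] #= [set: Omega]) \/
        (singular_card Omega /\
           forall N : set Omega, N #< [set: Omega] ->
             large_fibres v N #= [set: Omega])] in
  semigroup_gen (Sym Omega `|` [set f; g]) = [set: Omega -> Omega] <->
  good f g \/ good g f.
Proof.
move=> good; split; last first.
  by move=> [[? ? ? ?]|[? ? ? ?]]; [|rewrite [[set f; g]]setUC]; exact: sufficiency.
move=> gen.
have nbij h : injective h -> range h = [set: Omega] -> bijective h.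
  by move=> hinj hsurj; rewrite -setTT_bijective; split=> //;
    [move=> x y _ _; exact: hinj|rewrite /set_surj hsurj].
have [[finj nf]|[ginj ng]] := generator_inj_nonbij infOmega gen;
  have [[fsurj _]|[gsurj _]] := generator_surj_nonbij infOmega gen.
- by case: nf; exact: nbij.
- by left; have [] := necessity infOmega gen finj gsurj.
- right; rewrite [[set f; g]]setUC in gen.
  by have [] := necessity infOmega gen ginj fsurj.
- by case: ng; exact: nbij.
Qed.
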